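(* Let $s\in\mathbb N$ and $\boldsymbol\mu=(\mu^1,\mu^2)\in\mathcal P(\mathcal X)\times\mathcal P(\mathcal X)$ be arbitrary. Consider the quadratic cost $c(x_1,x_2)=\|x_1-x_2\|^2/2$ and the entropic optimal transport map $T^{\boldsymbol\mu}$. Let $\hat{\boldsymbol\mu}_n=(\hat\mu_n^1,\hat\mu_n^2)$ be the pair of empirical distributions of independent i.i.d. samples of size $n$ from $\mu^1$ and $\mu^2$, and let $\hat T_n=T^{\hat{\boldsymbol\mu}_n}$. Let $\boldsymbol G^{\boldsymbol\mu}=(G_1^{\boldsymbol\mu},G_2^{\boldsymbol\mu})$ be the zero-mean Gaussian random variable in $\mathcal C^s(\mathcal X)\times\mathcal C^s(\mathcal X)$ that is the limit in distribution of $\sqrt n(\boldsymbol\varphi^{\hat{\boldsymbol\mu}_n}-\boldsymbol\varphi^{\boldsymbol\mu})$ in $\mathcal C^s(\mathcal X)\times\mathcal C^s(\mathcal X)$ (this limit exists). Then, as $n\to\infty$, $$\sqrt n\,\big(\hat T_n-T^{\boldsymbol\mu}\big)\stackrel{d}{\to}-\nabla G_1^{\boldsymbol\mu}\quad\text{in }\mathcal C^{s-1}(\mathcal X;\mathbb R^d),$$ and $-\nabla G_1^{\boldsymbol\mu}$ is a zero-mean Gaussian random variable in $\mathcal C^{s-1}(\mathcal X;\mathbb R^d)$.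
   Context: Fix $d\in\mathbb N$, $\varepsilon>0$ and a bounded closed ball $\mathcal X\subset\mathbb R^d$; $c(x_1,x_2)=\|x_1-x_2\|^2/2$. $\mathcal P(\mathcal X)$ is the set of Borel probability measures on $\mathcal X$. Fix a reference point $(x_1^\circ,x_2^\circ)\in\mathcal X\times\mathcal X$. EOT potentials: for $\boldsymbol\mu=(\mu^1,\mu^2)\in\mathcal P(\mathcal X)\times\mathcal P(\mathcal X)$, $\boldsymbol\varphi^{\boldsymbol\mu}=(\varphi_1^{\boldsymbol\mu},\varphi_2^{\boldsymbol\mu})$ denotes the unique pair in $\mathcal C(\mathcal X)\times\mathcal C(\mathcal X)$ such that $\int e^{(\varphi_1(x_1)+\varphi_2(x_2)-c(x_1,x_2))/\varepsilon}\,d\mu^2(x_2)=1$ for all $x_1\in\mathcal X$, $\int e^{(\varphi_1(x_1)+\varphi_2(x_2)-c(x_1,x_2))/\varepsilon}\,d\mu^1(x_1)=1$ for all $x_2\in\mathcal X$, and $\varphi_1(x_1^\circ)=\varphi_2(x_2^\circ)$. These functions belong to $\mathcal C^s(\mathcal X)$ for every $s$. EOT map: for $x_1\in\mathcal X$, $$T^{\boldsymbol\mu}(x_1)=\frac{\int_{\mathcal X}x_2\,e^{(\varphi_2^{\boldsymbol\mu}(x_2)-\|x_1-x_2\|^2/2)/\varepsilon}\,d\mu^2(x_2)}{\int_{\mathcal X}e^{(\varphi_2^{\boldsymbol\mu}(x_2)-\|x_1-x_2\|^2/2)/\varepsilon}\,d\mu^2(x_2)}.$$ $\mathcal C^s(\mathcal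 X)$ is the Banach space of functions on $\mathcal X$ having continuous derivatives of all orders $\le s$ on $\mathrm{int}(\mathcal X)$ that extend continuously to $\mathcal X$, with norm $\|f\|_{\mathcal C^s(\mathcal X)}=\sum_{j=0}^s\max_{|k|=j}\|D^kf\|_{\infty,\mathrm{int}(\mathcal X)}$ ($\mathcal C^0=\mathcal C$). $\mathcal C^{s}(\mathcal X;\mathbb R^d)$ consists of maps $f=(f_1,\dots,f_d):\mathcal X\to\mathbb R^d$ with $f_j\in\mathcal C^s(\mathcal X)$, with norm $\sum_{j=1}^d\|f_j\|_{\mathcal C^s(\mathcal X)}$. A random variable $G$ in a Banach space $\mathbb B$ is (zero-mean) Gaussian if $b^*G$ is a (zero-mean) real Gaussian variable for every $b^*\in\mathbb B^*$. $\stackrel{d}{\to}$ denotes convergence in distribution. *)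

(* Defs.v *)
From HB Require Import structures.
From mathcomp Require Import all_boot all_order all_algebra.
From mathcomp Require Import all_classical all_reals all_analysis.
From mathcomp Require Import ring lra.

Set Implicit Arguments.
Unset Strict Implicit.
Unset Printing Implicit Defensive.

Import Order.TTheory GRing.Theory Num.Theory.
Import numFieldNormedType.Exports.

Local Open Scope classical_set_scope.
Local Open Scope ring_scope.

Section euclidean.
Context {R : realType} {d : nat}.
Implicit Types x y a : 'rV[R]_d.

Definition enorm x : R := Num.sqrt (\sum_i x 0 i ^+ 2).

Definition eball a (r : {posnum R}) : set 'rV[R]_d :=
  [set x | enorm (x - a) <= r%:num].

Definition quad_cost x y : R := enorm (x - y) ^+ 2 / 2.

Definition dirv (i : 'I_d) : 'rV[R]_d := delta_mx 0 i.

(* [iter_pderiv [:: i1; ...; ij] f] is the partial derivative of [f] along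
   [ij], then ..., then [i1]. *)
Definition iter_pderiv (w : seq 'I_d) (f : 'rV[R]_d -> R) : 'rV[R]_d -> R :=
  foldr (fun i g => fun x => 'D_(dirv i) g x) f w.

(* A multi-index of order [j] has entries at most [j]; its word repeats [i]
   exactly [k i] times, in increasing order of [i]. *)
Definition mi_word j (k : {ffun 'I_d -> 'I_j.+1}) : seq 'I_d :=
  flatten [seq nseq (k i) i | i <- enum 'I_d].

Definition mi_deriv j (k : {ffun 'I_d -> 'I_j.+1}) (f : 'rV[R]_d -> R) :=
  iter_pderiv (mi_word k) f.

End euclidean.


Section ball_topology.
Context {R : realType} {d : nat}.
Variables (a : 'rV[R]_d) (r : {posnum R}).

Let sqd (x : 'rV[R]_d) : R := \sum_i (x - a) 0 i ^+ 2.

Let sqd_ge0 x : 0 <= sqd x.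
Proof. by apply: sumr_ge0 => i _; exact: sqr_ge0. Qed.

Let sqd_continuous : continuous sqd.
Proof.
rewrite /sqd; apply: continuous_big => [|i _]; first exact: add_continuous.
have cv : continuous (fun y : 'rV[R]_d => (y - a) 0 i).
  have -> : (fun y : 'rV[R]_d => (y - a) 0 i) = (fun y => y 0 i - a 0 i).
    by apply/funext => y; rewrite !mxE.
  move=> y; apply: (@continuousB _ R^o); last exact: cst_continuous.
  exact: coord_continuous.
by move=> y; apply: (continuousM (cv y) (cv y)).
Qed.

Let eballE x : eball a r x = (sqd x <= r%:num ^+ 2).
Proof.
rewrite /eball/= /enorm -[in RHS](sqr_sqrtr (sqd_ge0 x)).
by rewrite ler_sqr // nnegrE ?sqrtr_ge0.
Qed.

Lemma eball_compact : compact (eball a r).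
Proof.
apply: bounded_closed_compact; last first.
  have -> : eball a r = sqd @^-1` [set y | y <= r%:num ^+ 2].
    by apply/seteqP; split => x; rewrite eballE.
  apply: preimage_closed; first by move=> x _; exact: sqd_continuous.
  exact: closed_le.
exists (r%:num + `|a|); split; first by rewrite num_real.
move=> M rM x; rewrite eballE => xX.
apply: le_trans (ltW rM).
rewrite -[x](subrK a) (le_trans (ler_normD _ _))// lerD2r.
rewrite [leLHS]/Num.Def.normr/= mx_normrE; apply/bigmax_leP; split => //= -[i j] _ /=.
rewrite ord1 -ler_sqr ?nnegrE//.
rewrite real_normK ?num_real//; apply: le_trans xX.
by rewrite /sqd (bigD1 j)//= lerDl sumr_ge0// => k _; exact: sqr_ge0.
Qed.

Lemma eball_segment x (t : R) : eball a r x -> 0 < t -> t < 1 ->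
  (eball a r)° (x + t *: (a - x)).
Proof.
rewrite eballE => xX t0 t1.
have sqdE : sqd (x + t *: (a - x)) = (1 - t) ^+ 2 * sqd x.
  rewrite /sqd mulr_sumr; apply: eq_bigr => i _; rewrite !mxE -exprMn.
  by congr (_ ^+ 2); ring.
have op : open (sqd @^-1` [set y | y < r%:num ^+ 2]).
  by apply: open_comp => [y _|]; [exact: sqd_continuous|exact: open_lt].
rewrite /interior; apply: filterS (open_nbhs_nbhs (conj op _)) => /=.
  by move=> y /ltW; rewrite eballE.
rewrite sqdE; have [->|s0] := eqVneq (sqd x) 0; first by rewrite mulr0 exprn_gt0.
apply: lt_le_trans xX; rewrite gtr_pMl ?lt0r ?s0//=.
by rewrite expr_lt1 ?subr_ge0 ?ltW//; rewrite ltrBlDr ltrDl.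
Qed.

Lemma within_eball_eq0 (f : 'rV[R]_d -> R) :
  {within eball a r, continuous f} ->
  (forall x, (eball a r)° x -> f x = 0) -> forall x, eball a r x -> f x = 0.
Proof.
move=> cf f0 x xX.
have cfx : f @ within (eball a r) (nbhs x) --> f x.
  exact: ((@subspace_continuousP _ (eball a r) _ f).1 cf x xX).
have tx : (fun t : R => x + t *: (a - x)) @ 0^'+ --> within (eball a r) (nbhs x).
  move=> A /= wA.
  have c0 : (x + t *: (a - x)) @[t --> (0:R)^'+] --> x.
    rewrite -[X in _ --> X]addr0 -(scale0r (a - x)).
    apply: cvgD; first exact: cvg_cst.
    apply: cvgZl; apply: cvg_at_right_filter; exact: cvg_id.
  have H : \forall t \near (0:R)^'+, eball a r (x + t *: (a - x)) -> A (x + t *: (a - x)) by exact: c0 _ wA.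
  change (\forall t \near (0:R)^'+, A (x + t *: (a - x))).
  near=> t.
  have : eball a r (x + t *: (a - x)).
    apply: interior_subset; apply: eball_segment => //; near: t.
  by near: t.
have c1 : f (x + t *: (a - x)) @[t --> (0:R)^'+] --> f x by exact: cvg_comp tx cfx.
have c2 : f (x + t *: (a - x)) @[t --> (0:R)^'+] --> (0 : R).
  apply: cvg_near_cst; near=> t.
  by apply: f0; apply: eball_segment => //; near: t.
by rewrite -(cvg_lim (@Rhausdorff R) c1) (cvg_lim (@Rhausdorff R) c2).
Unshelve. all: by end_near. Qed.

End ball_topology.

Definition sup_on {R : realType} {T : Type} (D : set T) (f : T -> R) : R :=
  sup [set `|f x| | x in D].

Section iter_pderiv_theory.
Context {R : realType} {d : nat}.
Implicit Types (f g : 'rV[R]_d -> R) (U : set 'rV[R]_d) (w : seq 'I_d).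

Lemma iter_pderiv_eq U f g w : open U -> (forall x, U x -> f x = g x) ->
  forall x, U x -> iter_pderiv w f x = iter_pderiv w g x.
Proof.
move=> oU fg; elim: w => [//|i w IH] x Ux /=.
apply: near_eq_derive; apply: filterS (open_nbhs_nbhs (conj oU Ux)) => y.
exact: IH.
Qed.

Lemma derivable_eq U f g x v : open U -> (forall y, U y -> f y = g y) ->
  U x -> derivable f x v -> derivable g x v.
Proof.
move=> oU fg Ux; apply: near_eq_derivable.
by apply: filterS (open_nbhs_nbhs (conj oU Ux)) => y /fg.
Qed.

Lemma iter_pderiv_linear U n c f g : open U ->
  (forall w i, (size w < n)%N -> forall x, U x ->
     derivable (iter_pderiv w f) x (dirv i)) ->
  (forall w i, (size w < n)%N -> forall x, U x ->
     derivable (iter_pderiv w g) x (dirv i)) ->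
  forall w, (size w <= n)%N -> forall x, U x ->
    iter_pderiv w (c *: f + g) x = c * iter_pderiv w f x + iter_pderiv w g x.
Proof.
move=> oU df dg; elim=> [//|i w IH] sw x Ux /=.
transitivity ('D_(dirv i) (c *: iter_pderiv w f + iter_pderiv w g) x).
  apply: near_eq_derive; apply: filterS (open_nbhs_nbhs (conj oU Ux)) => y Uy.
  by rewrite IH // ltnW.
rewrite deriveD; [|by apply: derivableZ; exact: df|exact: dg].
by rewrite deriveZ//; exact: df.
Qed.

Lemma size_mi_word j (k : {ffun 'I_d -> 'I_j.+1}) :
  size (mi_word k) = (\sum_i k i)%N.
Proof.
rewrite /mi_word size_flatten /shape -map_comp sumnE big_map big_enum /=.
by apply: eq_bigr => i _; rewrite size_nseq.
Qed.

End iter_pderiv_theory.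

Section Cs.
Context {R : realType} {d : nat}.
Variables (a : 'rV[R]_d) (r : {posnum R}) (s : nat).
Local Notation X := (eball a r).

(* A function on [X] is represented by its extension by 0 outside of [X]. The
   last clause, at [w = [::]], is implied by the second one. All the iterated
   partial derivatives, in every order of differentiation, are required. *)
Definition is_Cs (f : 'rV[R]_d -> R) : Prop :=
  [/\ forall x, ~ X x -> f x = 0,
      {within X, continuous f},
      forall w i, (size w < s)%N -> forall x, X° x ->
        derivable (iter_pderiv w f) x (dirv i)
    & forall w, (size w <= s)%N -> exists g : 'rV[R]_d -> R,
        {within X, continuous g} /\ forall x, X° x -> iter_pderiv w f x = g x].

Definition Cs_pred : {pred ('rV[R]_d -> R)} := mem [set f | is_Cs f].

Record Cs := MkCs { Cs_fun :> 'rV[R]_d -> R ; Cs_funP : Cs_fun \in Cs_pred }.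
HB.instance Definition _ := [isSub for Cs_fun].
HB.instance Definition _ := [Choice of Cs by <:].

Lemma Cs_submod_closed : submod_closed Cs_pred.
Proof.
have it0 w x : iter_pderiv w (0 : 'rV[R]_d -> R) x = 0.
  elim: w x => [//|i w IH] x /=.
  have -> : iter_pderiv w 0 = cst 0 :> ('rV[R]_d -> R) by apply/funext.
  exact: derive_cst.
split=> [|c f g].
  rewrite inE /=; split => //.
  - by apply: continuous_subspaceT => x; exact: cst_continuous.
  - move=> w i _ x _.
    have -> : iter_pderiv w 0 = cst 0 :> ('rV[R]_d -> R) by apply/funext.
    exact: derivable_cst.
  - move=> w _; exists (cst 0); split=> [|x _]; last exact: it0.
    by apply: continuous_subspaceT => x; exact: cst_continuous.
rewrite !inE /= => -[f0 cf df ef] [g0 cg dg eg].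
have wlin (p q : 'rV[R]_d -> R) : {within X, continuous p} ->
    {within X, continuous q} -> {within X, continuous (c *: p + q)}.
  by move=> cp cq x; apply: cvgD; [apply: cvgZr; exact: cp|exact: cq].
have lin := iter_pderiv_linear c (@open_interior _ X) df dg.
split.
- by move=> x Xx; rewrite !fctE /= f0// g0// scaler0 addr0.
- exact: wlin.
- move=> w i sw x Xx.
  apply: (@derivable_eq _ _ X° (c *: iter_pderiv w f + iter_pderiv w g)) => //.
  + exact: open_interior.
  + by move=> y Xy; rewrite lin// ltnW.
  + by apply: derivableD; [apply: derivableZ; exact: df|exact: dg].
- move=> w sw; have [p [cp fp]] := ef w sw; have [q [cq gq]] := eg w sw.
  exists (c *: p + q); split; first exact: wlin.
  by move=> x Xx; rewrite lin// fp// gq.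
Qed.
HB.instance Definition _ := GRing.isSubmodClosed.Build _ _ Cs_pred Cs_submod_closed.
HB.instance Definition _ := [SubChoice_isSubLmodule of Cs by <:].

Definition Cs_norm (f : Cs) : R :=
  \sum_(j < s.+1)
    \big[Num.max/0]_(k : {ffun 'I_d -> 'I_j.+1} | (\sum_i k i == j)%N)
      sup_on X° (mi_deriv k f).

Let Cs_funE (f : Cs) : is_Cs f.
Proof. by have := Cs_funP f; rewrite inE. Qed.

Let sup_on_ub (f : Cs) w x : (size w <= s)%N -> X° x ->
  `|iter_pderiv w f x| <= sup_on X° (iter_pderiv w f).
Proof.
move=> sw Xx; have [_ _ _ /(_ w sw)[g [cg fg]]] := Cs_funE f.
apply: ub_le_sup; last by exists x.
have /compact_bounded[M [Mr bM]] := continuous_compact cg (@eball_compact R d a r).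
exists (M + 1) => _ [y Xy <-]; rewrite fg//; apply: (bM (M + 1)).
  by rewrite ltrDl.
by exists y => //; exact: interior_subset.
Qed.

Let sup_on_le (f : 'rV[R]_d -> R) M : (forall x, X° x -> `|f x| <= M) ->
  sup_on X° f <= M.
Proof.
move=> fM; apply: ge_sup; last by move=> _ [x Xx <-]; exact: fM.
have := @eball_segment R d a r a (1/2) => /(_ _ _ _) H.
eexists; exists (a + (1/2) *: (a - a)) => //; apply: H; last 2 first.
- by [].
- by lra.
by rewrite /eball/= subrr /enorm big1 ?sqrtr0// => i _; rewrite mxE expr0n.
Qed.

Let sup_on_ge0 (f : Cs) w : (size w <= s)%N ->
  0 <= sup_on X° (iter_pderiv w f).
Proof.
move=> sw; apply: le_trans (sup_on_ub f sw (x := a + (1/2) *: (a - a)) _) => //.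
apply: eball_segment; [|lra|lra].
by rewrite /eball/= subrr /enorm big1 ?sqrtr0// => i _; rewrite mxE expr0n.
Qed.

Let size_mi j (k : {ffun 'I_d -> 'I_j.+1}) : (j < s.+1)%N ->
  (\sum_i k i == j)%N -> (size (mi_word k) <= s)%N.
Proof. by move=> js /eqP kj; rewrite size_mi_word kj. Qed.

Let iter_lin c (f g : Cs) w x : (size w <= s)%N -> X° x ->
  iter_pderiv w (c *: f + g) x = c * iter_pderiv w f x + iter_pderiv w g x.
Proof.
move=> sw Xx; have [_ _ df _] := Cs_funE f; have [_ _ dg _] := Cs_funE g.
exact: (iter_pderiv_linear c (@open_interior _ X) df dg).
Qed.

Let Cs_norm_ge0 f : 0 <= Cs_norm f.
Proof.
by apply: sumr_ge0 => j _; elim/big_ind: _ => // [x y x0 y0|k kj];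
  [rewrite le_max x0|apply: sup_on_ge0; exact: size_mi].
Qed.

Let iterD (f g : Cs) w x : (size w <= s)%N -> X° x ->
  iter_pderiv w (f + g) x = iter_pderiv w f x + iter_pderiv w g x.
Proof. by move=> sw Xx; have := iter_lin 1 f g sw Xx; rewrite scale1r mul1r. Qed.

Let iterZ c (f : Cs) w x : (size w <= s)%N -> X° x ->
  iter_pderiv w (c *: f) x = c * iter_pderiv w f x.
Proof.
move=> sw Xx; have := iter_lin c f 0 sw Xx; rewrite addr0 => ->.
suff -> : iter_pderiv w (0 : Cs) x = 0 by rewrite addr0.
have := iterD 0 0 sw Xx; rewrite addr0 => /eqP.
by rewrite -subr_eq0 opprD addrA subrr sub0r oppr_eq0 => /eqP.
Qed.

Lemma Cs_ler_normD f g : Cs_norm (f + g) <= Cs_norm f + Cs_norm g.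
Proof.
rewrite /Cs_norm -big_split/=; apply: ler_sum => j _.
have nn (h : Cs) : 0 <= \big[Num.max/0]_(k : {ffun 'I_d -> 'I_j.+1}
    | (\sum_i k i == j)%N) sup_on X° (mi_deriv k h) by exact: bigmax_ge_id.
apply/bigmax_leP; split; first by rewrite addr_ge0.
move=> k kj; have sk := size_mi (ltn_ord j) kj.
apply: sup_on_le => x Xx; rewrite /mi_deriv iterD//.
rewrite (le_trans (ler_normD _ _))// lerD//.
  exact: le_trans (sup_on_ub f sk Xx) (le_bigmax_cond _ _ kj).
exact: le_trans (sup_on_ub g sk Xx) (le_bigmax_cond _ _ kj).
Qed.

Let Cs_norm_leZ (l : R) f : Cs_norm (l *: f) <= `|l| * Cs_norm f.
Proof.
rewrite /Cs_norm mulr_sumr; apply: ler_sum => j _.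
apply/bigmax_leP; split; first by rewrite mulr_ge0 ?bigmax_ge_id.
move=> k kj; have sk := size_mi (ltn_ord j) kj.
apply: sup_on_le => x Xx; rewrite /mi_deriv iterZ// normrM ler_wpM2l//.
exact: le_trans (sup_on_ub f sk Xx) (le_bigmax_cond _ _ kj).
Qed.

Lemma Cs_normrZ (l : R) f : Cs_norm (l *: f) = `|l| * Cs_norm f.
Proof.
apply/eqP; rewrite eq_le Cs_norm_leZ/=.
have [->|l0] := eqVneq l 0; first by rewrite normr0 mul0r Cs_norm_ge0.
have := Cs_norm_leZ l^-1 (l *: f); rewrite scalerA mulVf// scale1r normfV.
by rewrite mulrC ler_pdivlMr ?normr_gt0// mulrC.
Qed.

Lemma Cs_normr0_eq0 f : Cs_norm f = 0 -> f = 0.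
Proof.
move=> nf0; apply/val_inj/funext => x /=.
have [fX cf _ _] := Cs_funE f.
have [Xx|/fX//] := pselect (X x).
apply: (within_eball_eq0 cf) Xx => {}x Xx; apply/eqP; rewrite -normr_le0 -nf0.
pose k : {ffun 'I_d -> 'I_1} := [ffun=> ord0].
have k0 : (\sum_i k i == @ord0 s)%N.
  by rewrite big1// => i _; rewrite ffunE.
rewrite /Cs_norm (bigD1 ord0)//= -[leLHS]addr0; apply: lerD.
  apply: le_trans (le_bigmax_cond _ _ k0).
  have sk : size (mi_word k) = 0%N.
    by rewrite size_mi_word; exact/eqP.
  have := @sup_on_ub f (mi_word k) x.
  by rewrite /mi_deriv (size0nil sk)//; exact.
apply: sumr_ge0 => j _; exact: bigmax_ge_id.
Qed.

HB.instance Definition _ :=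
  Lmodule_isNormed.Build R Cs Cs_ler_normD Cs_normrZ Cs_normr0_eq0.

(* C^s(X; R^d), by components. *)
Definition CsV := {ffun 'I_d -> Cs}.
HB.instance Definition _ := GRing.Lmodule.on CsV.

Definition CsV_norm (f : CsV) : R := \sum_i `|f i|.

Lemma CsV_ler_normD f g : CsV_norm (f + g) <= CsV_norm f + CsV_norm g.
Proof.
by rewrite /CsV_norm -big_split/=; apply: ler_sum => i _; rewrite ffunE ler_normD.
Qed.

Lemma CsV_normrZ (l : R) f : CsV_norm (l *: f) = `|l| * CsV_norm f.
Proof.
by rewrite /CsV_norm mulr_sumr; apply: eq_bigr => i _; rewrite ffunE normrZ.
Qed.

Lemma CsV_normr0_eq0 f : CsV_norm f = 0 -> f = 0.
Proof.
move=> /eqP; rewrite psumr_eq0// => /allP f0; apply/ffunP => i; rewrite ffunE.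
by apply/eqP; rewrite -normr_eq0; apply: f0; rewrite mem_index_enum.
Qed.

HB.instance Definition _ :=
  Lmodule_isNormed.Build R CsV CsV_ler_normD CsV_normrZ CsV_normr0_eq0.

End Cs.

Section gradient.
Context {R : realType} {d : nat} {a : 'rV[R]_d} {r : {posnum R}} {s : nat}.
Local Notation X := (eball a r).

(* The element of C^(s-1)(X) that coincides with the [i]-th partial derivative
   on the interior of [X]; it exists for [0 < s], and it is unique because the
   interior is dense in [X]. *)
Definition Cs_pderiv (i : 'I_d) (f : Cs a r s) : Cs a r s.-1 :=
  xget 0 [set u : Cs a r s.-1 | forall x, X° x -> u x = 'D_(dirv i) f x].

Lemma Cs_pderivE (i : 'I_d) (f : Cs a r s) x : (0 < s)%N -> X° x ->
  Cs_pderiv i f x = 'D_(dirv i) f x.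
Proof.
move=> s0 Xx; rewrite /Cs_pderiv; case: xgetP => [u _ /(_ x Xx)//|noext].
exfalso.
have : is_Cs a r s f by have := Cs_funP f; rewrite inE.
case=> f0 cf df ef; have [g [cg gE]] := ef [:: i] s0.
pose h x : R := if `[< X x >] then g x else 0.
have hT y : X y -> h y = g y by move=> Xy; rewrite /h asboolT.
have hE y : X° y -> h y = 'D_(dirv i) f y.
  by move=> Xy; rewrite hT; [rewrite -gE|exact: interior_subset].
have itE w y : X° y -> iter_pderiv w h y = iter_pderiv (rcons w i) f y.
  move=> Xy; rewrite /iter_pderiv foldr_rcons -!/(iter_pderiv _ _).
  exact: (iter_pderiv_eq w (@open_interior _ X) hE).
have hC : is_Cs a r s.-1 h.
  split.
  - by move=> y Xy; rewrite /h asboolF.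
  - by apply: subspace_eq_continuous cg => y; rewrite inE => /hT.
  - move=> w j sw y Xy.
    apply: (@derivable_eq _ _ X° (iter_pderiv (rcons w i) f)) => //.
    + exact: open_interior.
    + by move=> z Xz; rewrite itE.
    + by apply: df => //; rewrite size_rcons -ltn_predRL.
  - move=> w sw; have sw' : (size (rcons w i) <= s)%N.
      by rewrite size_rcons -(prednK s0) ltnS.
    have [p [cp pE]] := ef _ sw'; exists p; split=> // y Xy.
    by rewrite itE// pE.
by apply: (noext (MkCs (mem_set hC))) => y Xy; rewrite /= hE.
Qed.

Definition Cs_grad (f : Cs a r s) : CsV a r s.-1 := [ffun i => Cs_pderiv i f].

End gradient.

(* [open] is the topology of [T]; [borel T] is [T] with its Borel sets. *)
Notation borel T := (g_sigma_algebraType (@open T)).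

Section probability_notions.
Context {R : realType}.

Definition borel_rv d (Omega : measurableType d) (B : ptopologicalType)
    (Y : Omega -> B) : Prop :=
  measurable_fun [set: Omega] (Y : Omega -> borel B).

Definition cvg_in_distr d d' (Omega : measurableType d)
    (Omega' : measurableType d') (P : probability Omega R)
    (P' : probability Omega' R) (B : normedModType R)
    (Y : nat -> Omega -> B) (G : Omega' -> B) : Prop :=
  [/\ forall n, borel_rv (Y n), borel_rv G
    & forall h : B -> R, continuous h -> (exists M, forall b, `|h b| <= M) ->
        ('E_P[h \o Y n])%E @[n --> \oo] --> ('E_P'[h \o G])%E].

(* Convergence in distribution in [B] of random functions [f n w : F] that are
   not given as elements of [B]: [repr b g] means that [b : B] is the function
   [g]. The existence of representatives says that [f n w] belongs to [B]. *)
Definition cvg_in_distr_of d d' (Omega : measurableType d)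
    (Omega' : measurableType d') (P : probability Omega R)
    (P' : probability Omega' R) (B : normedModType R) (F : Type)
    (repr : B -> F -> Prop) (f : nat -> Omega -> F) (G : Omega' -> B) : Prop :=
  exists Y : nat -> Omega -> B,
    (forall n w, repr (Y n w) (f n w)) /\ cvg_in_distr P P' Y G.

(* [normal_prob 0 0] is not the Dirac mass, so the degenerate case is apart. *)
Definition real_gaussian0 d (Omega : measurableType d) (P : probability Omega R)
    (Y : Omega -> R) : Prop :=
  exists2 sigma : R, 0 <= sigma & forall A : set R, measurable A ->
    P (Y @^-1` A) = if sigma == 0 then \d_(0 : R) A else normal_prob 0 sigma A.

Definition gaussian0 d (Omega : measurableType d) (P : probability Omega R)
    (B : normedModType R) (G : Omega -> B) : Prop :=
  borel_rv G /\
  forall b : {scalar B}, continuous b -> real_gaussian0 P (b \o G).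

Definition mutually_independent d d' (Omega : measurableType d)
    (T : measurableType d') (P : probability Omega R) (I : choiceType)
    (Y : I -> Omega -> T) : Prop :=
  forall (J : seq I) (A : I -> set T), uniq J ->
    (forall i, measurable (A i)) ->
    P (\bigcap_(i in [set` J]) (Y i @^-1` A i)) =
      (\prod_(i <- J) P (Y i @^-1` A i))%E.

(* Two independent sequences of i.i.d. [X]-valued random variables with laws
   [mu1] and [mu2]. *)
Definition iid_samples d d' (Omega : measurableType d) (T : measurableType d')
    (P : probability Omega R) (mu1 mu2 : probability T R) (X : set T)
    (X1 X2 : nat -> Omega -> T) : Prop :=
  [/\ forall i, measurable_fun [set: Omega] (X1 i) /\
                measurable_fun [set: Omega] (X2 i),
      forall i w, X (X1 i w) /\ X (X2 i w),
      forall i A, measurable A -> P (X1 i @^-1` A) = mu1 A /\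
                                  P (X2 i @^-1` A) = mu2 A
    & mutually_independent P
        (fun k : nat + nat => match k with inl i => X1 i | inr i => X2 i end)].

End probability_notions.

Section empirical.
Context {R : realType} d (T : measurableType d).

(* Empirical distribution of the [n.+1] points [x 0, ..., x n]. *)
Definition empirical (x : nat -> T) (n : nat) : set T -> \bar R :=
  mscale (n.+1%:R^-1)%:nng (msum (fun i => \d_(x i)) n.+1).

HB.instance Definition _ x n := Measure.on (empirical x n).

Let empirical_setT x n : empirical x n [set: T] = 1%E.
Proof.
rewrite /empirical /mscale /= /msum.
rewrite (eq_bigr (fun=> 1%:E)) => [|i _]; last exact: diracT.
by rewrite sumEFin sumr_const card_ord -EFinM -mulr_natl mulr1 mulVf.
Qed.

HB.instance Definition _ x n :=
  Measure_isProbability.Build _ _ _ (empirical x n) (empirical_setT x n).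

End empirical.

Section entropic_optimal_transport.
Context {R : realType} {d : nat}.
Variables (eps : R) (a : 'rV[R]_d) (r : {posnum R}).
Local Notation X := (eball a r).

Definition borel_prob := probability (borel 'rV[R]_d) R.

Definition is_eot_potentials (x1o x2o : 'rV[R]_d) (mu1 mu2 : borel_prob)
    (phi : Cs a r 0 * Cs a r 0) : Prop :=
  [/\ forall x1, X x1 ->
        (\int[mu2]_(x2 in X)
          (expR ((phi.1 x1 + phi.2 x2 - quad_cost x1 x2) / eps))%:E = 1)%E,
      forall x2, X x2 ->
        (\int[mu1]_(x1 in X)
          (expR ((phi.1 x1 + phi.2 x2 - quad_cost x1 x2) / eps))%:E = 1)%E
    & phi.1 x1o = phi.2 x2o].

(* [phi mu1 mu2] is the pair of potentials of [(mu1, mu2)], for all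
   probability measures [mu1] and [mu2] on [X]. *)
Definition eot_potential_map (x1o x2o : 'rV[R]_d)
    (phi : borel_prob -> borel_prob -> Cs a r 0 * Cs a r 0) : Prop :=
  forall mu1 mu2 : borel_prob, mu1 X = 1%E -> mu2 X = 1%E ->
    is_eot_potentials x1o x2o mu1 mu2 (phi mu1 mu2).

Definition eot_map (phi : borel_prob -> borel_prob -> Cs a r 0 * Cs a r 0)
    (mu1 mu2 : borel_prob) (x1 : 'rV[R]_d) : 'rV[R]_d :=
  let phi2 := (phi mu1 mu2).2 in
  \row_i
    ((\int[mu2]_(x2 in X) (x2 0 i * expR ((phi2 x2 - quad_cost x1 x2) / eps)))%R
     / (\int[mu2]_(x2 in X) expR ((phi2 x2 - quad_cost x1 x2) / eps))%R).

End entropic_optimal_transport.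

(* Main.v *)
Require Import Defs.
From HB Require Import structures.
From mathcomp Require Import all_boot all_order all_algebra.
From mathcomp Require Import all_classical all_reals all_analysis.
From mathcomp Require Import ring lra.

Set Implicit Arguments.
Unset Strict Implicit.
Unset Printing Implicit Defensive.

Import Order.TTheory GRing.Theory Num.Theory.
Import numFieldNormedType.Exports.

Local Open Scope classical_set_scope.
Local Open Scope ring_scope.

(** The entropic map is the identity minus the gradient of the first potential.
    The first Schroedinger equation says that [exp (- phi1 x / eps)] is the
    integral over [mu2] of the Gibbs weight
    [exp ((phi2 y - |x - y|^2 / 2) / eps)].  The weight is smooth in [x], with
    derivatives dominated on the compact ball, so one may differentiate under
    the integral sign; the logarithmic derivative of the integral then brings
    in the barycentre [T x] of the weight, and [grad phi1 x = x - T x] in the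
    interior of the ball ([potential_gradient]).  Subtracting this identity for
    two pairs of measures gives
    [sqrt n (T_hat - T) = - grad (sqrt n (phi1_hat - phi1))].  It extends to
    the boundary because the entropic map is continuous along the radii of the
    ball ([eot_map_continuous_line], [eq_on_eball]).

    Hence the rescaled error of the map is the image of the rescaled error of
    the potentials under [opp_grad], the map [(u1, u2) |-> - grad u1].  This map
    is linear and continuous from [C^s x C^s] to [C^(s-1)], so it preserves
    convergence in distribution ([cvg_in_distr_comp]) and Gaussianity
    ([gaussian0_comp]).

    The continuity of [opp_grad] needs some care: the [C^s] norm takes, for each
    multi-index, the partial derivatives in increasing order of the coordinates,
    whereas differentiating a gradient takes one of them out of order.  The
    symmetry of second derivatives ([derive_comm]) reorders the derivatives
    ([iter_pderiv_perm]), after which the norm of each component of the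
    gradient is at most that of the function ([norm_Cs_pderiv]). *)

(** * Symmetry of second derivatives *)

Lemma eq_of_close (R : realType) (A B : R) :
  (forall e, 0 < e -> exists z, `|A - z| < e /\ `|B - z| < e) -> A = B.
Proof.
move=> AB; apply/eqP; rewrite -subr_eq0 -normr_le0.
apply/ler_addgt0Pl => e e0; rewrite addr0.
have [|z []] := AB (e / 2); first lra.
by rewrite !ltr_norml ler_norml => /andP[? ?] /andP[? ?]; apply/andP; split; lra.
Qed.

Section mixed_derivatives.
Context {R : realType} {V : normedModType R}.
Implicit Types (g : V -> R) (x u v : V).

(** A directional derivative is the derivative of a function of one real
    variable, for which the mean value theorem and the chain rule are
    available. *)
Lemma is_derive_lineP g x u (t l : R) : is_derive (x + t *: u) u g l <->
  is_derive t 1 (fun t : R => g (x + t *: u)) l.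
Proof.
have E : (fun h : R => h^-1 *: (((fun t => g (x + t *: u)) \o shift t) (h *: 1)
      - g (x + t *: u))) =
    (fun h => h^-1 *: ((g \o shift (x + t *: u)) (h *: u) - g (x + t *: u))).
  apply/funext => h /=; congr (_ *: (g _ - _)).
  by rewrite [_%:A]mulr1 scalerDl addrCA.
have dE : derivable (fun t : R => g (x + t *: u)) t 1 = derivable g (x + t *: u) u.
  by rewrite /derivable E.
have DE : 'D_1 (fun t : R => g (x + t *: u)) t = 'D_u g (x + t *: u).
  by rewrite /derive E.
by split=> -[dg <-]; split; rewrite ?dE ?DE // -dE.
Qed.

Lemma is_derive_line g x u (t : R) : derivable g (x + t *: u) u ->
  is_derive t 1 (fun t : R => g (x + t *: u)) ('D_u g (x + t *: u)).
Proof. by move=> /derivableP /is_derive_lineP. Qed.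

Lemma MVT_line g x u (h : R) : 0 < h ->
  (forall t, 0 <= t <= h -> derivable g (x + t *: u) u) ->
  exists2 c, 0 <= c <= h & g (x + h *: u) - g x = h * 'D_u g (x + c *: u).
Proof.
move=> h0 dg; have [| |c] := @MVT R (fun t : R => g (x + t *: u))
    (fun t => 'D_u g (x + t *: u)) 0 h h0.
- move=> t /[!in_itv]/= /andP[t0 th]; apply: is_derive_line; apply: dg.
  by rewrite !ltW.
- apply: derivable_within_continuous => t /[!in_itv]/= th.
  by have [] := is_derive_line (dg t th).
move=> /[!in_itv]/= /andP[c0 ch]; rewrite scale0r addr0 subr0 mulrC => ->.
by exists c; rewrite // !ltW.
Qed.

(** The mean value theorem is applied twice: along [u] to the increment
    [y |-> g (y + h *: v) - g y], then along [v] to ['D_u g]. *)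
Lemma second_difference g x u v (h : R) : 0 < h ->
  (forall s t, 0 <= s <= h -> 0 <= t <= h ->
     derivable g (x + s *: u + t *: v) u /\
     derivable ('D_u g) (x + s *: u + t *: v) v) ->
  exists s t, [/\ 0 <= s <= h, 0 <= t <= h &
    g (x + h *: u + h *: v) - g (x + h *: u) - g (x + h *: v) + g x =
    h ^+ 2 * 'D_v ('D_u g) (x + s *: u + t *: v)].
Proof.
move=> h0 dg.
have h00 : 0 <= (0 : R) <= h by rewrite lexx ltW.
have hhh : 0 <= h <= h by rewrite lexx ltW.
pose psi y := g (y + h *: v) - g y.
have dpsi s : 0 <= s <= h ->
    is_derive (x + s *: u) u psi
      ('D_u g (x + s *: u + h *: v) - 'D_u g (x + s *: u)).
  move=> sh; apply: is_deriveB; last first.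
    by apply: derivableP; have [] := dg s 0 sh h00; rewrite scale0r addr0.
  have [dgsh _] := dg s h sh hhh.
  have E : (fun k : R => k^-1 *: (((fun y => g (y + h *: v)) \o shift (x + s *: u))
        (k *: u) - g (x + s *: u + h *: v))) =
      (fun k => k^-1 *: ((g \o shift (x + s *: u + h *: v)) (k *: u)
        - g (x + s *: u + h *: v))).
    by apply/funext => k /=; rewrite !addrA.
  by split; rewrite /derivable /derive E.
have [s sh psiE] := MVT_line h0 (fun s sh => let: DeriveDef e _ := dpsi s sh in e).
have [t th DE] := MVT_line h0 (fun t th => (dg s t sh th).2).
exists s, t; split => //.
rewrite expr2 -mulrA -DE; have [_ <-] := dpsi s sh; rewrite -psiE /psi; ring.
Qed.

Lemma ball_close (U : set V) (F F' : V -> R) x (e : R) : open U -> U x ->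
  {for x, continuous F} -> {for x, continuous F'} -> 0 < e ->
  exists2 r, 0 < r & forall y, ball x r y ->
    [/\ U y, `|F x - F y| < e & `|F' x - F' y| < e].
Proof.
move=> oU Ux cF cF' e0.
have nU : nbhs x U by exact: open_nbhs_nbhs.
have /cvgrPdist_lt/(_ _ e0) c1 := cF.
have /cvgrPdist_lt/(_ _ e0) c2 := cF'.
have : nbhs x (U `&` ([set y | `|F x - F y| < e] `&`
    [set y | `|F' x - F' y| < e])).
  by apply: filterI => //; apply: filterI; [exact: c1|exact: c2].
move=> /nbhs_ballP[r /= r0 rB].
by exists r => // y /rB[? [? ?]].
Qed.

(** The second difference of [g] on a parallelogram is symmetric in its two
    sides, so it equals [h ^+ 2] times a value of each mixed derivative; as
    [h] tends to 0, both values tend to those at [x]. *)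
Lemma derive_comm g (U : set V) u v : open U ->
  (forall x, U x -> [/\ derivable g x u, derivable g x v,
     derivable ('D_u g) x v & derivable ('D_v g) x u]) ->
  (forall x, U x -> {for x, continuous ('D_v ('D_u g))}) ->
  (forall x, U x -> {for x, continuous ('D_u ('D_v g))}) ->
  forall x, U x -> 'D_v ('D_u g) x = 'D_u ('D_v g) x.
Proof.
move=> oU dg cvu cuv x Ux; apply: (@eq_of_close R) => e e0.
have [r r0 rB] := ball_close oU Ux (cvu x Ux) (cuv x Ux) e0.
(* The parallelogram of sides [h *: u] and [h *: v] at [x] stays in the ball. *)
pose h := r / (2 * (`|u| + `|v| + 1)).
have N0 : 0 < `|u| + `|v| + 1 by rewrite ltr_wpDl// addr_ge0.
have h0 : 0 < h by rewrite divr_gt0// mulr_gt0.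
have hr : h * (`|u| + `|v| + 1) < r.
  by rewrite /h invfM mulrA divfK ?gt_eqF//; lra.
have near_x s t : 0 <= s <= h -> 0 <= t <= h -> ball x r (x + s *: u + t *: v).
  move=> /andP[s0 sh] /andP[t0 th]; rewrite -ball_normE /=.
  rewrite -addrA opprD addNKr normrN; apply: le_lt_trans hr.
  rewrite (le_trans (ler_normD _ _))// !normrZ !ger0_norm//.
  rewrite !mulrDr mulr1 -[leLHS]addr0; apply: lerD; last exact: ltW.
  by apply: lerD; apply: ler_wpM2r.
have [s [t [sh th E1]]] := @second_difference g x u v h h0 (fun s t sh th =>
  let: And4 a _ b _ := dg _ (let: And3 a _ _ := rB _ (near_x s t sh th) in a)
  in conj a b).
have near_x' t1 s1 : 0 <= t1 <= h -> 0 <= s1 <= h ->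
    ball x r (x + t1 *: v + s1 *: u).
  by move=> th' sh'; rewrite addrAC; exact: near_x.
have [t' [s' [th' sh' E2]]] := @second_difference g x v u h h0 (fun s t sh th =>
  let: And4 _ a _ b := dg _ (let: And3 a _ _ := rB _ (near_x' s t sh th) in a)
  in conj a b).
have DD : 'D_v ('D_u g) (x + s *: u + t *: v) = 'D_u ('D_v g) (x + t' *: v + s' *: u).
  have h2 : h ^+ 2 != 0 by rewrite expf_neq0// gt_eqF.
  apply: (mulfI h2); rewrite -E1 -E2 [x + h *: v + _]addrAC; ring.
have [_ c1 _] := rB _ (near_x s t sh th).
have [_ _ c2] := rB _ (near_x' t' s' th' sh').
by exists ('D_v ('D_u g) (x + s *: u + t *: v)); split; [exact: c1|rewrite DD; exact: c2].
Qed.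

End mixed_derivatives.

(** * Reordering iterated partial derivatives *)

Section words.
Context {R : realType} {d : nat}.
Variables (U : set 'rV[R]_d) (n : nat) (f : 'rV[R]_d -> R).
Hypothesis oU : open U.
Hypothesis df : forall w i, (size w < n)%N -> forall x, U x ->
  derivable (iter_pderiv w f) x (dirv i).
Hypothesis cf : forall w, (size w <= n)%N -> forall x, U x ->
  {for x, continuous (iter_pderiv w f)}.

(** The letter [i] moves to the front by successive exchanges with its left
    neighbour, each an instance of [derive_comm]. *)
Lemma iter_pderiv_front u i v : (size (u ++ i :: v) <= n)%N -> forall x, U x ->
  iter_pderiv (u ++ i :: v) f x = iter_pderiv (i :: u ++ v) f x.
Proof.
elim: u => [//|j u IH] /= sn x Ux.
have sn' : (size (u ++ v)).+2 = (size (u ++ i :: v)).+1 by rewrite !size_cat addnS.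
transitivity (iter_pderiv [:: j] (iter_pderiv (i :: u ++ v) f) x).
  by apply: (iter_pderiv_eq [:: j] oU) Ux => y Uy; apply: IH Uy; exact: ltnW.
rewrite -sn' in sn.
apply: (@derive_comm _ _ (iter_pderiv (u ++ v) f) U (dirv i) (dirv j) oU) Ux.
- by move=> y Uy; split; [apply: df|apply: df|apply: (df (w := i :: _))|
    apply: (df (w := j :: _))] => //; exact: ltnW.
- by move=> y Uy; apply: (@cf [:: j, i & u ++ v]).
- by move=> y Uy; apply: (@cf [:: i, j & u ++ v]).
Qed.

Lemma iter_pderiv_perm w1 w2 : perm_eq w1 w2 -> (size w1 <= n)%N ->
  forall x, U x -> iter_pderiv w1 f x = iter_pderiv w2 f x.
Proof.
elim: w1 w2 => [|i w1 IH] w2; first by rewrite perm_sym => /perm_nilP ->.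
move=> p; have iw2 : i \in w2 by rewrite -(perm_mem p) mem_head.
move: p; case/splitPr: iw2 => u v p sn x Ux.
have p' : perm_eq w1 (u ++ v).
  by rewrite -(perm_cons i) (permPl p) (permEl (perm_catCA u [:: i] v)).
rewrite iter_pderiv_front//; last by rewrite -(perm_size p).
by apply: (iter_pderiv_eq [:: i] oU) Ux => y Uy; apply: IH => //; exact: ltnW.
Qed.

End words.

Section mi_words.
Context {d : nat}.

Lemma count_mi_word j (k : {ffun 'I_d -> 'I_j.+1}) x :
  count_mem x (mi_word k) = k x.
Proof.
rewrite /mi_word count_flatten -map_comp sumnE big_map big_enum/=.
rewrite (bigD1 x)//= big1 ?addn0 => [|i /negbTE ix].
  by rewrite count_nseq/= eqxx mul1n.
by rewrite count_nseq/= ix.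
Qed.

(** [inord] does not truncate: the entries of [k] are at most [j]. *)
Definition mi_incr j (k : {ffun 'I_d -> 'I_j.+1}) i : {ffun 'I_d -> 'I_j.+2} :=
  [ffun l => inord (k l + (l == i))].

Lemma mi_incrE j (k : {ffun 'I_d -> 'I_j.+1}) i l :
  mi_incr k i l = (k l + (l == i))%N :> nat.
Proof.
rewrite ffunE inordK// -addn1 -(addn1 j.+1); case: (l == i); last first.
  by rewrite addn0 leq_add2r ltnW.
by rewrite leq_add2r addn1.
Qed.

Lemma perm_mi_incr j (k : {ffun 'I_d -> 'I_j.+1}) i :
  perm_eq (rcons (mi_word k) i) (mi_word (mi_incr k i)).
Proof.
apply/allP => x _ /=; rewrite count_mi_word mi_incrE -cats1 count_cat.
by rewrite count_mi_word/= addn0 (eq_sym i).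
Qed.

Lemma sum_mi_incr j (k : {ffun 'I_d -> 'I_j.+1}) i :
  (\sum_l mi_incr k i l)%N = (\sum_l k l).+1.
Proof.
by rewrite -!size_mi_word -(perm_size (perm_mi_incr k i)) size_rcons.
Qed.

End mi_words.

(** * The gradient is continuous from C^s to C^(s-1) *)

Section Cs_calculus.
Context {R : realType} {d : nat} {a : 'rV[R]_d} {r : {posnum R}}.
Local Notation X := (eball a r).

Lemma Cs_is_Cs s (f : Cs a r s) : is_Cs a r s f.
Proof. by have := Cs_funP f; rewrite inE. Qed.

Lemma CsE s c (f g : Cs a r s) x : (c *: f + g) x = c * f x + g x.
Proof. by []. Qed.

(** The interior is dense in the ball. *)
Lemma Cs_eqP s (f g : Cs a r s) : (forall x, X° x -> f x = g x) -> f = g.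
Proof.
move=> fg; apply/val_inj/funext => x /=.
have [f0 cf _ _] := Cs_is_Cs f; have [g0 cg _ _] := Cs_is_Cs g.
have [Xx|nX] := pselect (X x); last by rewrite f0// g0.
apply/eqP; rewrite -subr_eq0; apply/eqP.
apply: (@within_eball_eq0 R d a r (fun x => f x - g x)) Xx => [|y Xy].
  by move=> y; apply: cvgB; [exact: cf|exact: cg].
by rewrite fg// subrr.
Qed.

Lemma within_eball_continuous (g : 'rV[R]_d -> R) x :
  {within X, continuous g} -> X° x -> {for x, continuous g}.
Proof.
move=> cg Xx.
have : {within X°, continuous g}.
  by apply: continuous_subspaceW cg; exact: interior_subset.
rewrite continuous_open_subspace; last exact: open_interior.
by apply; rewrite inE.
Qed.

Lemma Cs_iter_continuous s (f : Cs a r s) w x : (size w <= s)%N -> X° x ->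
  {for x, continuous (iter_pderiv w f)}.
Proof.
move=> sw Xx; have [_ _ _ /(_ w sw)[g [cg fg]]] := Cs_is_Cs f.
have cgx := within_eball_continuous cg Xx.
have nX : \forall y \near x, g y = iter_pderiv w f y.
  have : nbhs x X° by apply: open_nbhs_nbhs; split => //; exact: open_interior.
  by apply: filterS => y Xy; rewrite fg.
rewrite /prop_for /continuous_at fg//.
exact: (cvg_trans (near_eq_cvg (FF := nbhs_filter x) nX) cgx).
Qed.

Lemma iter_pderiv_Cs_pderiv s (f : Cs a r s) i w x : (0 < s)%N -> X° x ->
  iter_pderiv w (Cs_pderiv i f) x = iter_pderiv (rcons w i) f x.
Proof.
move=> s0 Xx; rewrite /iter_pderiv foldr_rcons -!/(iter_pderiv _ _).
apply: (iter_pderiv_eq w (@open_interior _ X)) Xx => y Xy.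
exact: Cs_pderivE.
Qed.

Lemma Cs_pderiv_linear s i c (f g : Cs a r s) : (0 < s)%N ->
  Cs_pderiv i (c *: f + g) = c *: Cs_pderiv i f + Cs_pderiv i g.
Proof.
move=> s0; apply: Cs_eqP => x Xx; rewrite CsE !Cs_pderivE//.
have [_ _ df _] := Cs_is_Cs f; have [_ _ dg _] := Cs_is_Cs g.
exact: (iter_pderiv_linear c (@open_interior _ X) df dg (w := [:: i])).
Qed.

(** Up to the order of differentiation, the derivatives of [Cs_pderiv i f] of
    order [j] are among those of [f] of order [j.+1]; the term of order 0 in
    the norm of [f] is left over. *)
Lemma norm_Cs_pderiv s i (f : Cs a r s) : (0 < s)%N ->
  `|Cs_pderiv i f| <= `|f|.
Proof.
case: s f => // s f _; rewrite /Num.norm/= /Cs_norm/=.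
have nn j : 0 <= \big[Num.max/0]_(k : {ffun 'I_d -> 'I_j.+1} | (\sum_i k i == j)%N)
    sup_on X° (mi_deriv k f) by exact: bigmax_ge_id.
rewrite [leRHS]big_ord_recl/= -[leLHS]add0r; apply: lerD; first exact: nn.
apply: ler_sum => j _; apply/bigmax_leP; split; first exact: nn.
move=> k kj.
have -> : sup_on X° (mi_deriv k (Cs_pderiv i f)) =
          sup_on X° (mi_deriv (mi_incr k i) f).
  congr sup; apply: eq_imagel => x Xx; congr (`|_|).
  rewrite /mi_deriv iter_pderiv_Cs_pderiv//.
  have [_ _ df _] := Cs_is_Cs f.
  apply: (iter_pderiv_perm (@open_interior _ X) df) Xx => //.
  - by move=> w sw y Xy; exact: (Cs_iter_continuous sw Xy).
  - exact: perm_mi_incr.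
  - by rewrite size_rcons size_mi_word (eqP kj) ltn_ord.
rewrite -[bump 0 j]/(j.+1).
by apply: (le_bigmax_cond _ (fun k => sup_on X° (mi_deriv k f)));
  rewrite sum_mi_incr (eqP kj).
Qed.

Lemma Cs_grad_linear s c (f g : Cs a r s) : (0 < s)%N ->
  Cs_grad (c *: f + g) = c *: Cs_grad f + Cs_grad g.
Proof. by move=> s0; apply/ffunP => i; rewrite !ffunE Cs_pderiv_linear. Qed.

Lemma norm_Cs_grad s (f : Cs a r s) : (0 < s)%N -> `|Cs_grad f| <= d%:R * `|f|.
Proof.
move=> s0; rewrite {1}/Num.norm/= /CsV_norm mulr_natl.
have -> : `|f| *+ d = \sum_(i < d) `|f| by rewrite sumr_const card_ord.
by apply: ler_sum => i _; rewrite ffunE norm_Cs_pderiv.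
Qed.

Definition opp_grad s (u : Cs a r s * Cs a r s) : CsV a r s.-1 := - Cs_grad u.1.

Lemma opp_grad_linear s : (0 < s)%N -> linear (@opp_grad s).
Proof.
by move=> s0 c u v; rewrite /opp_grad /= Cs_grad_linear// opprD scalerN.
Qed.

Lemma opp_grad_continuous s : (0 < s)%N -> continuous (@opp_grad s).
Proof.
move=> s0.
pose D : {linear _ -> _} := HB.pack (@opp_grad s)
  (GRing.isLinear.Build _ _ _ _ _ (opp_grad_linear s0)).
apply: (@bounded_linear_continuous _ _ _ D); apply/bounded_funP => M.
exists (d%:R * M) => u uM; rewrite /= /opp_grad normrN.
rewrite (le_trans (norm_Cs_grad _ s0))// ler_wpM2l//.
by apply: le_trans uM; rewrite prod_normE le_max lexx.
Qed.

End Cs_calculus.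

(** * Continuous images of convergence in distribution and of Gaussian laws *)

Section continuous_mapping.
Context {R : realType}.

Lemma borel_rv_comp d (Omega : measurableType d) (B B' : ptopologicalType)
    (D : B -> B') (Y : Omega -> B) : continuous D -> borel_rv Y -> borel_rv (D \o Y).
Proof.
move=> /continuousP cD mY; apply: (@measurability _ _ Omega (borel B') setT (D \o Y) (@open B')) => //.
move=> _ [V oV <-]; rewrite comp_preimage.
by apply: mY => //; apply: sub_sigma_algebra; exact: cD.
Qed.

Lemma cvg_in_distr_comp d d' (Omega : measurableType d)
    (Omega' : measurableType d') (P : probability Omega R)
    (P' : probability Omega' R) (B B' : normedModType R) (D : B -> B')
    (Y : nat -> Omega -> B) (G : Omega' -> B) : continuous D ->
  cvg_in_distr P P' Y G -> cvg_in_distr P P' (fun n => D \o Y n) (D \o G).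
Proof.
move=> cD [mY mG YG]; split; [by move=> n; exact: borel_rv_comp|exact: borel_rv_comp|].
move=> h ch [M hM]; apply: (YG (h \o D)); last by exists M => b; exact: hM.
by move=> x; apply: continuous_comp; [exact: cD|exact: ch].
Qed.

Lemma gaussian0_comp d (Omega : measurableType d) (P : probability Omega R)
    (B B' : normedModType R) (D : {linear B -> B'}) (G : Omega -> B) :
  continuous D -> gaussian0 P G -> gaussian0 P (D \o G).
Proof.
move=> cD [mG gG]; split; first exact: borel_rv_comp.
move=> b cb; apply: (gG (b \o D)) => x.
by apply: continuous_comp; [exact: cD|exact: cb].
Qed.

End continuous_mapping.

(** * Differentiating integrals of the Gibbs weight *)

Section ball_integrals.
Context {R : realType} {d : nat} {a : 'rV[R]_d} {r : {posnum R}}.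
Local Notation X := (eball a r).
Local Notation V := (borel 'rV[R]_d).

Lemma eball_measurable : measurable (X : set V).
Proof.
have cX : closed X.
  by apply: compact_closed; [exact: norm_hausdorff|exact: eball_compact].
rewrite -[X in measurable X]setCK; apply: measurableC.
by apply: sub_sigma_algebra; exact: closed_openC.
Qed.

Lemma within_continuous_measurable (g : 'rV[R]_d -> R) :
  {within X, continuous g} -> measurable_fun (X : set V) (g : V -> R).
Proof.
move=> /continuousP cg; apply: (measurability _ (measurable_realfun.RGenOpens.measurableE R)).
move=> _ [_ [u [v ->] <-]].
have /open_subspaceP[W oW WE] : open (g @^-1` `]u, v[%classic : set (subspace X)).
  by apply: cg; exact: interval_open.
rewrite setIC -WE; apply: measurableI; last exact: eball_measurable.
exact: sub_sigma_algebra.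
Qed.

Lemma within_continuous_integrable (mu : @borel_prob R d) (g : 'rV[R]_d -> R) :
  {within X, continuous g} -> mu.-integrable X (EFin \o g).
Proof.
move=> cg; apply: measurable_bounded_integrable.
- exact: eball_measurable.
- by apply: (le_lt_trans (probability_le1 mu eball_measurable)); rewrite ltry.
- exact: within_continuous_measurable.
- have /compact_bounded[M [Mr bM]] := continuous_compact cg (@eball_compact R d a r).
  exists M; split => // N MN y Xy; apply: bM MN _ _.
  by exists y.
Qed.

End ball_integrals.

Section gibbs_derivative.
Context {R : realType} {d : nat} {a : 'rV[R]_d} {r : {posnum R}}.
Local Notation X := (eball a r).
Local Notation V := (borel 'rV[R]_d).
Implicit Types x y v : 'rV[R]_d.

Definition dotp x y : R := \sum_i x 0 i * y 0 i.

Lemma dotp_dirv x i : dotp x (dirv i) = x 0 i.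
Proof.
rewrite /dotp (bigD1 i)//= big1 ?addr0 => [|j /negbTE ji].
  by rewrite /dirv mxE !eqxx mulr1.
by rewrite /dirv mxE ji andbF mulr0.
Qed.

Lemma quad_costE x y : quad_cost x y = dotp (x - y) (x - y) / 2.
Proof.
rewrite /quad_cost /enorm sqr_sqrtr; last by apply: sumr_ge0 => i _; exact: sqr_ge0.
by congr (_ / 2); apply: eq_bigr => i _; rewrite expr2.
Qed.

Lemma quad_cost_line x v y (t : R) : quad_cost (x + t *: v) y =
  quad_cost x y + t * dotp (x - y) v + t ^+ 2 / 2 * dotp v v.
Proof.
have -> : quad_cost x y + t * dotp (x - y) v + t ^+ 2 / 2 * dotp v v =
    (dotp (x - y) (x - y) + 2 * t * dotp (x - y) v + t ^+ 2 * dotp v v) / 2.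
  by rewrite quad_costE; field.
rewrite quad_costE; congr (_ / 2); rewrite /dotp !mulr_sumr -!big_split/=.
by apply: eq_bigr => i _; rewrite !mxE; ring.
Qed.

Lemma quad_cost_ge0 x y : 0 <= quad_cost x y.
Proof. by rewrite /quad_cost divr_ge0// sqr_ge0. Qed.

Lemma dotp_continuous (f g : 'rV[R]_d -> 'rV[R]_d) :
  continuous f -> continuous g -> continuous (fun y => dotp (f y) (g y)).
Proof.
move=> cf cg; apply: continuous_big => [|i _]; first exact: add_continuous.
move=> y; apply: continuousM.
  apply: (@continuous_comp _ _ _ f (fun z : 'rV[R]_d => z 0 i)); first exact: cf.
  exact: coord_continuous.
apply: (@continuous_comp _ _ _ g (fun z : 'rV[R]_d => z 0 i)); first exact: cg.
exact: coord_continuous.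
Qed.

Lemma subl_continuous x : continuous (fun y => x - y).
Proof.
move=> y; apply: (@continuousB _ _ _ (cst x) id); first exact: cst_continuous.
exact: cvg_id.
Qed.

Lemma dotpB_continuous x v : continuous (fun y => dotp (x - y) v).
Proof.
by apply: dotp_continuous; [exact: subl_continuous|move=> y; exact: cst_continuous].
Qed.

Lemma quad_cost_continuous x : continuous (quad_cost x).
Proof.
have -> : quad_cost x = (fun y => dotp (x - y) (x - y) / 2).
  by apply/funext => y; rewrite quad_costE.
have cdd : continuous (fun y => dotp (x - y) (x - y)).
  by apply: dotp_continuous; exact: subl_continuous.
by move=> y; exact: (continuousM (cdd y) (@cst_continuous _ R 2^-1 y)).
Qed.

Variables (eps : R) (psi : 'rV[R]_d -> R).
Hypotheses (eps0 : 0 < eps) (cpsi : {within X, continuous psi}).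

(** The density of the entropic plan at [(x, y)], up to a factor that depends
    only on [x]. *)
Definition gibbs x y : R := expR ((psi y - quad_cost x y) / eps).

Lemma gibbs_continuous x : {within X, continuous (gibbs x)}.
Proof.
move=> y; apply: (@continuous_comp (subspace X) R R
  (fun y => (psi y - quad_cost x y) / eps) expR); last exact: continuous_expR.
apply: cvgMr_tmp; apply: cvgB; first exact: cpsi.
exact: (continuous_subspaceT (quad_cost_continuous (x := x))).
Qed.

Lemma gibbs_line x v y (t : R) : gibbs (x + t *: v) y =
  expR ((psi y - quad_cost x y - (t * dotp (x - y) v + t ^+ 2 / 2 * dotp v v)) / eps).
Proof.
by rewrite /gibbs quad_cost_line -[quad_cost x y + _ + _]addrA opprD addrA.
Qed.

Lemma is_derive_expR_quadratic (k b c t : R) :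
  is_derive t 1 (fun t : R => expR ((k - (t * b + t ^+ 2 / 2 * c)) / eps))
    (- (b + t * c) / eps * expR ((k - (t * b + t ^+ 2 / 2 * c)) / eps)).
Proof.
have e0 : eps != 0 by rewrite gt_eqF.
have H : is_derive t (1 : R) (cst (k / eps) + (- b / eps) \*: (@id R) +
    (- c / (2 * eps)) \*: ((@id R) ^+ 2)) (- (b + t * c) / eps).
  by apply: is_derive_eq; rewrite add0r /= !scaler1 /GRing.scale/=; field.
have E : (fun t : R => (k - (t * b + t ^+ 2 / 2 * c)) / eps) = 
   (cst (k / eps) + (- b / eps) \*: (@id R) + (- c / (2 * eps)) \*: ((@id R) ^+ 2)).
  by apply/funext => u; rewrite !fctE /= /GRing.scale/=; field.
rewrite -E in H.
rewrite mulrC; exact: (is_derive1_comp (is_derive_expR _) H).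
Qed.

Variable mu : @borel_prob R d.

(** Along a line the exponent is quadratic in [t], with coefficients continuous
    in [y]; so for [t] in [(-1, 1)] the derivative of the integrand is bounded
    by an integrable function [G] of [y], and one may differentiate under the
    integral sign.  The factor [m] is 1 for the mass of the weight and a
    coordinate for its first moments. *)
Lemma is_derive_gibbs (m : 'rV[R]_d -> R) x v : {within X, continuous m} ->
  is_derive (0 : R) 1
    (fun t : R => \int[mu]_(y in X) (m y * gibbs (x + t *: v) y))%R
    (\int[mu]_(y in X) (m y * (- dotp (x - y) v / eps * gibbs x y)))%R.
Proof.
move=> cm.
pose f t y : R := m y * gibbs (x + t *: v) y.
pose b y := dotp (x - y) v; pose c := dotp v v.
have c0 : 0 <= c by apply: sumr_ge0 => i _; rewrite -expr2 sqr_ge0.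
have df (t : R) y : is_derive t (1 : R) (f ^~ y)
    (m y * (- (b y + t * c) / eps * gibbs (x + t *: v) y)).
  have -> : f ^~ y = m y \*: (fun t : R =>
      expR ((psi y - quad_cost x y - (t * b y + t ^+ 2 / 2 * c)) / eps)).
    by apply/funext => u; rewrite /f gibbs_line.
  rewrite gibbs_line.
  have H := is_derive_expR_quadratic (psi y - quad_cost x y) (b y) c t.
  exact: (is_deriveZ (m y) H).
(* The quadratic cost is nonnegative, so [gibbs _ y <= expR (psi y / eps)]. *)
pose G y := `|m y| * ((`|b y| + c) / eps * expR (psi y / eps)).
have cG : {within X, continuous G}.
  move=> y; apply: cvgM; first by apply: cvg_norm; exact: cm.
  apply: cvgM; last first.
    apply: (@continuous_comp (subspace X) R R (fun y => psi y / eps) expR).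
      by apply: cvgMr_tmp; exact: cpsi.
    exact: continuous_expR.
  apply: cvgMr_tmp; apply: cvgD; last exact: cvg_cst.
  apply: cvg_norm.
  exact: (continuous_subspaceT (dotpB_continuous (x := x) (v := v))).
have G0 y : 0 <= G y by rewrite mulr_ge0// mulr_ge0 ?expR_ge0// divr_ge0 ?addr_ge0// ltW.
have I0 : `]-1, 1[%classic (0 : R) by rewrite /= in_itv/= ltrN10 ltr01.
have If (t : R) : `]-1, 1[%classic t -> mu.-integrable X (EFin \o f t).
  move=> _; apply: within_continuous_integrable => y.
  by apply: cvgM; [exact: cm|exact: gibbs_continuous].
have dfI (t : R) y : `]-1, 1[%classic t -> X y -> derivable (f ^~ y) t (1 : R).
  by move=> _ _; have [] := df t y.
have IG : mu.-integrable X (EFin \o G) by exact: within_continuous_integrable.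
have p1 (t : R) y : partial1of2 f t y = m y * (- (b y + t * c) / eps * gibbs (x + t *: v) y).
  by rewrite partial1of2E; have [_ ->] := df t y.
have Gub (t : R) y : `]-1, 1[%classic t -> X y -> `|partial1of2 f t y| <= G y.
  rewrite /= in_itv/= => /andP[t1 t2] Xy; rewrite p1 /G !normrM.
  rewrite ler_wpM2l//; apply: ler_pM => //.
    rewrite normfV (gtr0_norm eps0) ler_wpM2r ?invr_ge0 ?(ltW eps0)//.
    rewrite normrN (le_trans (ler_normD _ _))// lerD2l normrM (ger0_norm c0).
    by rewrite ler_piMl// ler_norml !ltW.
  rewrite /gibbs ger0_norm ?expR_ge0// ler_expR ler_pM2r ?invr_gt0//.
  by rewrite gerBl quad_cost_ge0.
have D := derivable_under_integral eball_measurable I0 If dfI G0 IG Gub.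
have E := differentiation_under_integral eball_measurable I0 If dfI G0 IG Gub.
apply: DeriveDef; first exact: D.
rewrite -derive1E E; apply: eq_Rintegral => y _.
by rewrite p1 mul0r addr0 scale0r addr0.
Qed.

Lemma gibbs_integral_continuous (m : 'rV[R]_d -> R) x v : {within X, continuous m} ->
  {for 0, continuous (fun t : R => \int[mu]_(y in X) (m y * gibbs (x + t *: v) y))%R}.
Proof.
move=> cm; apply: differentiable_continuous; apply/derivable1_diffP.
by have [] := is_derive_gibbs x v cm.
Qed.

End gibbs_derivative.

(** * The entropic map as a gradient *)

Section eot.
Context {R : realType} {d : nat} {a : 'rV[R]_d} {r : {posnum R}}.
Local Notation X := (eball a r).
Variables (eps : R) (x1o x2o : 'rV[R]_d).
Hypothesis eps0 : 0 < eps.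
Variable phi : @borel_prob R d -> @borel_prob R d -> Cs a r 0 * Cs a r 0.
Hypothesis hphi : eot_potential_map eps x1o x2o phi.
Variables mu1 mu2 : @borel_prob R d.
Hypotheses (hmu1 : mu1 X = 1%E) (hmu2 : mu2 X = 1%E).
Local Notation T := (eot_map eps phi mu1 mu2).
Local Notation phi1 := (phi mu1 mu2).1.
Local Notation psi := (phi mu1 mu2).2.

Let cpsi : {within X, continuous psi}.
Proof. by have [] := Cs_is_Cs psi. Qed.

Definition gibbs_mass x : R := (\int[mu2]_(y in X) (1 * gibbs eps psi x y))%R.
Definition gibbs_moment i x : R := (\int[mu2]_(y in X) (y 0 i * gibbs eps psi x y))%R.

Let c1 : {within X, continuous (fun=> 1 : R)}.
Proof. by apply: continuous_subspaceT => y; exact: cst_continuous. Qed.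

Let ccoord i : {within X, continuous (fun y : 'rV[R]_d => y 0 i)}.
Proof. by apply: continuous_subspaceT => y; exact: coord_continuous. Qed.

Let intg (m : 'rV[R]_d -> R) x : {within X, continuous m} ->
  mu2.-integrable X (EFin \o (fun y => m y * gibbs eps psi x y)).
Proof.
move=> cm; apply: within_continuous_integrable => y.
by apply: cvgM; [exact: cm|exact: gibbs_continuous].
Qed.

Lemma eot_mapE x i : T x 0 i = gibbs_moment i x / gibbs_mass x.
Proof.
rewrite /eot_map mxE; congr (_ / _).
by apply: eq_Rintegral => y _; rewrite mul1r.
Qed.

Lemma expR_potential x : X x -> expR (phi1 x / eps) * gibbs_mass x = 1.
Proof.
move=> Xx; have [/(_ x Xx) E _ _] := hphi hmu1 hmu2.
rewrite /gibbs_mass -RintegralZl; [|exact: eball_measurable|exact: intg].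
transitivity (fine (1%E : \bar R)) => //; rewrite -E; congr fine.
apply: eq_integral => y _; congr EFin; rewrite mul1r /gibbs -expRD.
by rewrite -mulrDl addrA.
Qed.

Lemma gibbs_mass_gt0 x : X x -> 0 < gibbs_mass x.
Proof.
by move=> /expR_potential E; rewrite -(pmulr_rgt0 _ (expR_gt0 (phi1 x / eps))) E.
Qed.

Lemma potentialE x : X x -> phi1 x = - eps * ln (gibbs_mass x).
Proof.
move=> Xx; have := congr1 (@ln R) (expR_potential Xx).
rewrite lnM ?posrE ?expR_gt0 ?gibbs_mass_gt0// expRK ln1 => /eqP.
rewrite addr_eq0 => /eqP E.
by rewrite mulNr -mulrN -E mulrC divfK// gt_eqF.
Qed.

(** By [potentialE], the gradient of [phi1] is [- eps] times the logarithmic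
    derivative of [gibbs_mass]; differentiating the weight in the [i]-th
    coordinate multiplies it by [(y 0 i - x 0 i) / eps]. *)
Lemma potential_gradient x i : X° x ->
  is_derive x (dirv i) phi1 (x 0 i - T x 0 i).
Proof.
move=> Xx; have XX := interior_subset Xx.
have nX : \forall y \near x, - eps * ln (gibbs_mass y) = phi1 y.
  have : nbhs x X° by apply: open_nbhs_nbhs; split => //; exact: open_interior.
  by apply: filterS => y /interior_subset Xy; rewrite potentialE.
apply: (near_eq_is_derive nX).
have Z0 := gibbs_mass_gt0 XX; set Z := gibbs_mass x in Z0.
have dM : is_derive (0 : R) 1 (fun t : R => gibbs_mass (x + t *: dirv i))
    (- (x 0 i * Z - gibbs_moment i x) / eps).
  apply: is_derive_eq; first exact: is_derive_gibbs.
  transitivity (\int[mu2]_(y in X) (- eps^-1 *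
      (x 0 i * (1 * gibbs eps psi x y) - y 0 i * gibbs eps psi x y)))%R.
    apply: eq_Rintegral => y _; rewrite dotp_dirv !mxE; ring.
  have mX := @eball_measurable R d a r.
  have ixg : mu2.-integrable X (EFin \o (fun y => x 0 i * (1 * gibbs eps psi x y))).
    apply: within_continuous_integrable => y.
    apply: cvgM; first exact: cvg_cst.
    by apply: cvgM; [exact: c1|exact: gibbs_continuous].
  rewrite RintegralZl//; last first.
    apply: within_continuous_integrable => y; apply: cvgB.
      apply: cvgM; first exact: cvg_cst.
      by apply: cvgM; [exact: c1|exact: gibbs_continuous].
    by apply: cvgM; [exact: ccoord|exact: gibbs_continuous].
  rewrite RintegralB//; last exact: intg.
  rewrite RintegralZl//; last exact: intg.
  rewrite -/(gibbs_mass x) -/(gibbs_moment i x) -/Z; ring.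
have := (is_derive_lineP (fun y => - eps * ln (gibbs_mass y)) x (dirv i) 0 (x 0 i - T x 0 i)).2.
rewrite scale0r addr0; apply.
have dln : is_derive (gibbs_mass (x + 0 *: dirv i)) 1 (@ln R) Z^-1.
  by rewrite scale0r addr0; exact: is_derive1_ln.
have -> : (fun t : R => - eps * ln (gibbs_mass (x + t *: dirv i))) =
    (- eps) \*: (@ln R \o (fun t : R => gibbs_mass (x + t *: dirv i))) by [].
have H := is_deriveZ (- eps) (is_derive1_comp dln dM).
rewrite (_ : x 0 i - _ = - eps *: (Z^-1 * (- (x 0 i * Z - gibbs_moment i x) / eps))).
  exact: H.
rewrite eot_mapE -/Z /GRing.scale/=; field.
by rewrite !gt_eqF.
Qed.

Lemma eot_map_continuous_line x v i : X x ->
  {for 0, continuous (fun t : R => T (x + t *: v) 0 i)}.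
Proof.
move=> Xx.
have -> : (fun t : R => T (x + t *: v) 0 i) =
    (fun t => gibbs_moment i (x + t *: v) / gibbs_mass (x + t *: v)).
  by apply/funext => t; rewrite eot_mapE.
apply: continuousM; first exact: gibbs_integral_continuous.
apply: continuousV; last exact: gibbs_integral_continuous.
by rewrite scale0r addr0 gt_eqF// gibbs_mass_gt0.
Qed.

End eot.

(** * Convergence of the empirical entropic map *)

Section radial.
Context {R : realType} {d : nat} {a : 'rV[R]_d} {r : {posnum R}}.
Local Notation X := (eball a r).

(** Continuity of [f] is only asked along the segments to the centre: these
    reach every point of the ball through its interior. *)
Lemma eq_on_eball (g f : 'rV[R]_d -> R) : {within X, continuous g} ->
  (forall x, X x -> {for 0, continuous (fun t : R => f (x + t *: (a - x)))}) ->
  (forall x, X° x -> g x = f x) -> forall x, X x -> g x = f x.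
Proof.
move=> cg cf gf x Xx; pose l (t : R) := x + t *: (a - x).
have lX : \forall t \near (0 : R)^'+, X° (l t).
  by near=> t; apply: eball_segment => //; near: t.
have cl : l t @[t --> (0 : R)^'+] --> x.
  rewrite -[X in _ --> X]addr0 -(scale0r (a - x)).
  apply: cvgD; first exact: cvg_cst.
  by apply: cvgZl; apply: cvg_at_right_filter; exact: cvg_id.
have cgl : g (l t) @[t --> (0 : R)^'+] --> g x.
  have cgx : g @ within X (nbhs x) --> g x.
    exact: ((@subspace_continuousP _ X _ g).1 cg x Xx).
  apply: cvg_comp cgx => A /= wA.
  have wl : \forall t \near (0 : R)^'+, X (l t) -> A (l t) by exact: cl _ wA.
  apply: filterS2 wl lX => t tA /interior_subset; exact: tA.
have cfl : f (l t) @[t --> (0 : R)^'+] --> f x.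
  have := cf x Xx; rewrite /prop_for/continuous_at scale0r addr0 => cf0.
  by apply: cvg_at_right_filter; exact: cf0.
have cfg : g (l t) @[t --> (0 : R)^'+] --> f x.
  apply: cvg_trans cfl; apply: near_eq_cvg; apply: filterS lX => t lt.
  by rewrite gf.
by rewrite -(cvg_lim (@Rhausdorff R) cgl) (cvg_lim (@Rhausdorff R) cfg).
Unshelve. all: by end_near. Qed.

Lemma empirical_eball (x : nat -> borel 'rV[R]_d) n :
  (forall i, X (x i)) -> @empirical R _ _ x n X = 1%E.
Proof.
move=> xX; rewrite /empirical /mscale /= /msum.
rewrite (eq_bigr (fun=> 1%:E)) => [|i _].
  by rewrite sumEFin sumr_const card_ord -EFinM -mulr_natl mulr1 mulVf.
transitivity ((x i \in X)%:R%:E : \bar R); first exact: diracE.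
by rewrite mem_set.
Qed.

End radial.

Theorem corollary1 (R : realType) (d : nat) (eps : R) (heps : 0 < eps)
  (a : 'rV[R]_d) (r : {posnum R})
  (x1o x2o : 'rV[R]_d) (hx1o : eball a r x1o) (hx2o : eball a r x2o)
  (phi : @borel_prob R d -> @borel_prob R d -> Cs a r 0 * Cs a r 0)
  (hphi : eot_potential_map eps x1o x2o phi)
  (s : nat) (hs : (0 < s)%N)
  (mu1 mu2 : @borel_prob R d)
  (hmu1 : mu1 (eball a r) = 1%E) (hmu2 : mu2 (eball a r) = 1%E)
  (dO : measure_display) (Omega : measurableType dO) (P : probability Omega R)
  (X1 X2 : nat -> Omega -> borel 'rV[R]_d)
  (hX : iid_samples P mu1 mu2 (eball a r) X1 X2)
  (dO' : measure_display) (Omega' : measurableType dO')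
  (P' : probability Omega' R)
  (G : Omega' -> Cs a r s * Cs a r s)
  (hG : gaussian0 P' G)
  (hlim :
    let phi_hat n w :=
      phi (empirical (X1 ^~ w) n) (empirical (X2 ^~ w) n) in
    cvg_in_distr_of P P'
      (fun (u : Cs a r s * Cs a r s) (f : ('rV[R]_d -> R) * ('rV[R]_d -> R)) =>
        forall x, eball a r x -> u.1 x = f.1 x /\ u.2 x = f.2 x)
      (fun n w =>
        (fun x => Num.sqrt n.+1%:R * ((phi_hat n w).1 x - (phi mu1 mu2).1 x),
         fun x => Num.sqrt n.+1%:R * ((phi_hat n w).2 x - (phi mu1 mu2).2 x)))
      G) :
  let T_hat n w :=
    eot_map eps phi (empirical (X1 ^~ w) n) (empirical (X2 ^~ w) n) in
  let T := eot_map eps phi mu1 mu2 in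
  cvg_in_distr_of P P'
    (fun (u : CsV a r s.-1) (f : 'rV[R]_d -> 'rV[R]_d) =>
      forall x i, eball a r x -> u i x = f x 0 i)
    (fun n w x => Num.sqrt n.+1%:R *: (T_hat n w x - T x))
    (fun w' => - Cs_grad (G w').1)
  /\ gaussian0 P' (fun w' => - Cs_grad (G w').1).
Proof.
move=> T_hat T; have [_ XX _ _] := hX.
pose D : {linear _ -> _} := HB.pack (@opp_grad R d a r s)
  (GRing.isLinear.Build _ _ _ _ _ (opp_grad_linear hs)).
split; last exact: (@gaussian0_comp _ _ _ _ _ _ D G (opp_grad_continuous hs) hG).
have [Y [repr cY]] := hlim.
exists (fun n w => opp_grad (Y n w)); split; last first.
  exact: cvg_in_distr_comp (opp_grad_continuous hs) cY.
move=> n w x i Xx.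
pose nu1 : @borel_prob R d := empirical (X1 ^~ w) n.
pose nu2 : @borel_prob R d := empirical (X2 ^~ w) n.
have hnu1 : nu1 (eball a r) = 1%E.
  by apply: empirical_eball => j; have [] := XX j w.
have hnu2 : nu2 (eball a r) = 1%E.
  by apply: empirical_eball => j; have [] := XX j w.
pose c : R := Num.sqrt n.+1%:R.
pose f y := c * (eot_map eps phi nu1 nu2 y 0 i - T y 0 i).
have -> : (c *: (T_hat n w x - T x)) 0 i = f x by rewrite /f !mxE.
have -> : opp_grad (Y n w) i x = - Cs_pderiv i (Y n w).1 x.
  by rewrite /opp_grad !ffunE.
(* The gradient formula holds in the interior only, hence the extension. *)
apply: (@eq_on_eball R d a r (fun x => - Cs_pderiv i (Y n w).1 x) f _ _ _ x Xx).
- have [_ cg _ _] := Cs_is_Cs (Cs_pderiv i (Y n w).1).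
  by move=> y; apply: cvgN; exact: cg.
- move=> y Xy; apply: cvgM; first exact: cvg_cst.
  by apply: cvgB; exact: (eot_map_continuous_line heps hphi).
move=> y Xy; rewrite Cs_pderivE//.
have nX : \forall z \near y, c * ((phi nu1 nu2).1 z - (phi mu1 mu2).1 z) = (Y n w).1 z.
  have : nbhs y (eball a r)° by apply: open_nbhs_nbhs; split => //; exact: open_interior.
  by apply: filterS => z /interior_subset Xz; have [-> _] := repr n w z Xz.
rewrite -(near_eq_derive _ nX).
have g1 := potential_gradient heps hphi hnu1 hnu2 i Xy.
have g2 := potential_gradient heps hphi hmu1 hmu2 i Xy.
have [_ ->] := is_deriveZ c (is_deriveB g1 g2).
rewrite /f /GRing.scale/=; ring.
Qed.
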